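(* Let $M$ be a $C^k$ submanifold of $\mathbb{R}^d$ with $k\ge1$. Then the projection $p$ is $C^{k-1}$ on $\mathcal{E}(M)$ and the distance function $\delta_M$ is $C^k$ on $\mathcal{E}(M)\setminus M$.
   Context: Submanifolds are nonempty. Let $0\le m<d$. A set $M\subseteq\mathbb{R}^d$ is an $m$-dimensional $C^k$ submanifold of $\mathbb{R}^d$ if for every $\xi\in M$ there are open sets $U,V\subseteq\mathbb{R}^d$ with $\xi\in U$ and a $C^k$ diffeomorphism $\Psi:V\to U$ such that for all $y\in V$: $\Psi(y)\in M\iff y_{m+1}=\dots=y_d=0$. The case $m=d$ is excluded throughout. $\delta_M(x)=d(x,M)=\inf_{\xi\in M}\|x-\xi\|$ (Euclidean norm). $\operatorname{unpp}(M)$ is the set of $x\in\mathbb{R}^d$ for which there is exactly one $\xi\in M$ with $\|x-\xi\|=d(x,M)$; this $\xi$ is denoted $p(x)$. $\mathcal{E}(M)$ is the interior of $\operatorname{unpp}(M)$. *)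

(* Defs.v *)
From HB Require Import structures.
From mathcomp Require Import all_boot all_order all_algebra.
From mathcomp Require Import all_classical all_reals all_analysis.
Set Implicit Arguments.
Unset Strict Implicit.
Unset Printing Implicit Defensive.
Import Order.TTheory GRing.Theory Num.Theory.
Import numFieldNormedType.Exports.
Local Open Scope classical_set_scope.
Local Open Scope ring_scope.

(* The library norm `|x| on 'rV[R]_d is the sup norm: it induces the usual
   topology and the usual notion of differentiability, but metric notions
   need the Euclidean norm. *)
Definition enorm (R : realType) (d : nat) (x : 'rV[R]_d) : R :=
  Num.sqrt (\sum_(i < d) x 0 i ^+ 2).

(* Meant for U open.  f is C^(k+1) on U iff f is Fréchet differentiable on U
   and Df is C^k on U.  Df takes values in the finite-dimensional space
   L(R^d, W), so it is C^k iff x |-> Df(x)(v) is C^k for every vector v. *)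
Fixpoint Ck (R : realType) (d : nat) (W : normedModType R) (k : nat)
    (U : set 'rV[R]_d) (f : 'rV[R]_d -> W) : Prop :=
  match k with
  | 0 => forall x, U x -> {for x, continuous f}
  | k'.+1 => (forall x, U x -> differentiable f x) /\
             (forall v : 'rV[R]_d, Ck k' U (fun x => 'd f x v))
  end.

(* Psi is total; only its restriction to V matters. *)
Definition Ck_diffeo (R : realType) (d k : nat) (V U : set 'rV[R]_d)
    (Psi : 'rV[R]_d -> 'rV[R]_d) : Prop :=
  [/\ set_bij V U Psi, Ck k V Psi &
      exists Phi : 'rV[R]_d -> 'rV[R]_d,
        (forall y, V y -> Phi (Psi y) = y) /\ Ck k U Phi].

(* Coordinates are indexed from 0, so y_(m+1) = ... = y_d = 0 reads
   y 0 i = 0 for all i with m <= i < d. *)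
Definition submanifold (R : realType) (d m k : nat) (M : set 'rV[R]_d) : Prop :=
  M !=set0 /\
  forall xi, M xi ->
    exists U V : set 'rV[R]_d, exists Psi : 'rV[R]_d -> 'rV[R]_d,
      [/\ open U, open V, U xi, Ck_diffeo k V U Psi &
          forall y, V y ->
            (M (Psi y) <-> forall i : 'I_d, (m <= i)%N -> y 0 i = 0)].

Definition dist_to (R : realType) (d : nat) (M : set 'rV[R]_d)
    (x : 'rV[R]_d) : R :=
  inf [set enorm (x - xi) | xi in M].

Definition nearest (R : realType) (d : nat) (M : set 'rV[R]_d)
    (x : 'rV[R]_d) : set 'rV[R]_d :=
  [set xi | M xi /\ enorm (x - xi) = dist_to M x].

Definition unpp (R : realType) (d : nat) (M : set 'rV[R]_d) : set 'rV[R]_d :=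
  [set x | exists! xi, nearest M x xi].

(* Extended outside unpp M by an arbitrary choice. *)
Definition proj_to (R : realType) (d : nat) (M : set 'rV[R]_d)
    (x : 'rV[R]_d) : 'rV[R]_d :=
  get (nearest M x).

Definition Eset (R : realType) (d : nat) (M : set 'rV[R]_d) : set 'rV[R]_d :=
  interior (unpp M).

(* Main.v *)
(* On the interior E of unpp(M) the projection p is continuous and
   |x - p x|^2 has differential 2 <x - p x, .>; this gives the case k = 1.
   For larger k, maximizing the squared distance to M over a small ball around
   x in E yields z beyond x on the ray from p x through x with p z = p x.
   Hence |x - q|^2 >= |x - p x|^2 + c |q - p x|^2 for q in M, with c > 0.  This
   makes p pointwise Lipschitz and the Hessian of |x - Psi w|^2 in a chart Psi
   nondegenerate at the minimizer u x.  The continuous solution u of the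
   stationarity equation is therefore differentiable, with the derivative
   prescribed by the implicit function theorem, and bootstrapping that formula
   gives u, hence p = Psi o u, of class C^(k-1).  Finally, the differential
   <x - p x, .> / dist(x, M) of the distance is bootstrapped in the same way. *)
Require Import Defs.
From HB Require Import structures.
From mathcomp Require Import all_boot all_order all_algebra.
From mathcomp Require Import all_classical all_reals all_analysis.
From mathcomp Require Import ring lra.
Set Implicit Arguments.
Unset Strict Implicit.
Unset Printing Implicit Defensive.
Import Order.TTheory GRing.Theory Num.Theory.
Import numFieldNormedType.Exports.
Local Open Scope classical_set_scope.
Local Open Scope ring_scope.

(** * Differentials *)

Lemma near_continuous (S T : topologicalType) (g : S -> T) (t : S)
    (P : T -> Prop) : {for t, continuous g} ->
  (\forall y \near g t, P y) -> \forall s \near t, P (g s).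
Proof. by move=> cg gP; refine (cg _ gP). Qed.

Section FrechetDifferential.
Context {R : realType} {V W : normedModType R}.
Implicit Types (f g : V -> W) (df : V -> W).

Lemma is_diff_of_le (f : V -> W) (df : {linear V -> W}) x :
  continuous df ->
  (forall e, 0 < e ->
    \forall h \near (0 : V), `|f (h + x) - f x - df h| <= e * `|h|) ->
  is_diff x f df.
Proof.
move=> cdf fdf.
have E : f \o shift x = cst (f x) + df +o_ (0 : V) id.
  apply/eqaddoP => e e0; have := fdf e e0; apply: filterS => h.
  by rewrite /= !fctE opprD addrA.
apply: DiffDef; last exact: diff_unique.
by apply/diff_locallyP; rewrite (diff_unique cdf E).
Qed.

Lemma diff_le f x e : differentiable f x -> 0 < e ->
  \forall h \near (0 : V), `|f (h + x) - f x - 'd f x h| <= e * `|h|.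
Proof.
move=> /diff_locally/eqaddoP H /H; apply: filterS => h.
by rewrite /= !fctE opprD addrA.
Qed.

Lemma near_shift0 (P : V -> Prop) (x : V) :
  (\forall y \near x, P y) -> \forall h \near (0 : V), P (h + x).
Proof. by rewrite (near_shift 0) subr0; apply: filterS. Qed.

Lemma near_eq_is_diff f g df x :
  (\forall y \near x, f y = g y) -> is_diff x f df -> is_diff x g df.
Proof.
move=> fg [dfx <-]; apply: is_diff_of_le; first exact: diff_continuous.
move=> e e0; have := diff_le dfx e0.
have fgx := nbhs_singleton fg.
by apply: filterS2 (near_shift0 fg) => h /= <-; rewrite fgx.
Qed.

Lemma diff_lipschitz f x : differentiable f x ->
  exists2 K, 0 < K & \forall y \near x, `|f y - f x| <= K * `|y - x|.
Proof.
move=> dfx; have [k k0 kP] := linear_lipschitz (diff_continuous dfx).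
(* The linear part contributes [k], the remainder at most [|h|]. *)
exists (k + 1); first by rewrite addr_gt0.
rewrite (near_shift 0) subr0.
apply: filterS (diff_le dfx ltr01) => h; rewrite mul1r /= addrK => fh.
rewrite -[X in `|X|](subrK ('d f x h)) (le_trans (ler_normD _ _))//.
by rewrite addrC mulrDl mul1r lerD.
Qed.
End FrechetDifferential.

Section DifferentialRules.
Context {R : realType} {V : normedModType R}.

Lemma is_diff_sum (W : normedModType R) (I : Type) (r : seq I) (P : pred I)
  (f df : I -> V -> W) x : (forall i, P i -> is_diff x (f i) (df i)) ->
  is_diff x (fun y => \sum_(i <- r | P i) f i y)
            (fun v => \sum_(i <- r | P i) df i v).
Proof.
move=> fdf; have -> : (fun y => \sum_(i <- r | P i) f i y) =
    \sum_(i <- r | P i) f i by apply/funext => y; rewrite fct_sumE.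
have -> : (fun y => \sum_(i <- r | P i) df i y) =
    \sum_(i <- r | P i) df i by apply/funext => y; rewrite fct_sumE.
elim/big_ind2 : _ => //; first exact: is_diff_cst.
by move=> f1 df1 f2 df2 h1 h2; exact: is_diffD.
Qed.

Lemma is_diff_mul (f g df dg : V -> R) x :
  is_diff x f df -> is_diff x g dg ->
  is_diff x (fun y => f y * g y) (fun v => f x * dg v + df v * g x).
Proof.
move=> hf hg; have := is_diffM hf hg => -[? E]; apply: DiffDef => //.
by rewrite [LHS]E; apply/funext => v; rewrite [df v * _]mulrC.
Qed.

Lemma is_diff_inv (f df : V -> R) x : is_diff x f df -> f x != 0 ->
  is_diff x (fun y => (f y)^-1) (fun v => - ((f x)^-1 * (f x)^-1 * df v)).
Proof.
move=> [hf <-] fx0; apply: DiffDef; first exact: differentiableV.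
rewrite diffV//; apply/funext => v /=.
by rewrite -expr2 exprVn scaleNr.
Qed.

Lemma is_diff_matrix m n (f df : V -> 'M[R]_(m, n)) x :
  (forall i j, is_diff x (fun y => f y i j) (fun v => df v i j)) ->
  is_diff x f df.
Proof.
move=> H; have Z (A : V -> 'M[R]_(m, n)) :
    A = fun y => \sum_i \sum_j A y i j *: delta_mx i j.
  by apply/funext => y; rewrite -matrix_sum_delta.
rewrite [f]Z [df]Z; apply: is_diff_sum => i _; apply: is_diff_sum => j _.
have [hij E] := H i j; apply: DiffDef; first exact: differentiableZl.
by rewrite diffZl// E.
Qed.

Lemma is_diff_coord m n (f df : V -> 'M[R]_(m, n)) x i j :
  is_diff x f df -> is_diff x (fun y => f y i j) (fun v => df v i j).
Proof.
have @c : {linear 'M[R]_(m, n) -> R}.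
  by exists (fun N : 'M[R]_(_, _) => N i j); do 2![eexists]; do ?[constructor];
     rewrite ?mxE// => ? *; rewrite ?mxE//; move=> ?; rewrite !mxE.
move=> hf; have hc : is_diff (f x) c c.
  apply: DiffDef; first exact/linear_differentiable/coord_continuous.
  by rewrite diff_lin//; exact: coord_continuous.
exact: (is_diff_comp hf hc).
Qed.

(** A positive derivative along [v] would beat the remainder and make [f] grow. Only one ray is
    tested, so the condition applies at a maximum on the boundary of a ball. *)
Lemma diff_ascent_le (f : V -> R) x v : differentiable f x ->
  (exists2 e0 : R, 0 < e0 &
    forall e : R, 0 < e -> e < e0 -> f (x + e *: v) <= f x) ->
  'd f x v <= 0.
Proof.
move=> dfx [e0 e0_gt0 fe]; rewrite leNgt; apply/negP => v0.
(* The relative error [c] satisfies [c * |v| < 'd f x v]; the added 1 keeps the denominator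
   positive. *)
pose c := 'd f x v / (`|v| + 1).
have c0 : 0 < c by rewrite divr_gt0// ltr_wpDl.
have cv : c * `|v| < 'd f x v.
  by rewrite /c mulrAC ltr_pdivrMr ?ltr_wpDl// ltr_pM2l// ltrDl.
have /nbhs_ballP[r /= r0 rP] := diff_le dfx c0.
pose e := Num.min (e0 / 2) (r / (`|v| + 1) / 2).
have re : 0 < r / (`|v| + 1) by rewrite divr_gt0// ltr_wpDl.
have e_gt0 : 0 < e by rewrite lt_min !divr_gt0.
have ee0 : e < e0 by rewrite gt_min ltr_pdivrMr// ltr_pMr// ltr1n.
have er : e < r / (`|v| + 1).
  by rewrite gt_min [X in _ || X]ltr_pdivrMr// ltr_pMr// ltr1n orbT.
have /rP : ball (0 : V) r (e *: v).
  rewrite -ball_normE /= sub0r normrN normrZ gtr0_norm//.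
  move: er; rewrite ltr_pdivlMr ?ltr_wpDl// mulrDr mulr1.
  by apply: le_lt_trans; rewrite lerDl ltW.
rewrite /= (addrC (e *: v)) normrZ (gtr0_norm e_gt0) linearZ /=.
have := fe e e_gt0 ee0; rewrite -subr_le0.
have : c * (e * `|v|) < e * 'd f x v by rewrite mulrCA ltr_pM2l.
move: (_ - f x) (c * (e * `|v|)) => D0 b.
rewrite -[e *: _]/(e * _); move: (e * _); clear => a.
move=> ba D0le /ler_normlP[+ _].
by lra.
Qed.

(** The one-sided condition for [- f], used along [v] and along [- v]. *)
Lemma diff_argmin0 (f : V -> R) x v : differentiable f x ->
  (\forall t \near (0 : R), f x <= f (x + t *: v)) -> 'd f x v = 0.
Proof.
move=> dfx /nbhs_ballP[r /= r0 rP].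
have dNf := differentiableN dfx.
have H w : w = v \/ w = - v -> 'd (- f) x w <= 0.
  move=> wv; apply: diff_ascent_le => //; exists r => // e e0 er.
  rewrite !fctE lerN2; case: wv => ->.
    by apply: rP; rewrite /ball /= sub0r normrN gtr0_norm.
  rewrite scalerN -scaleNr.
  by apply: rP; rewrite /ball /= sub0r opprK gtr0_norm.
have H1 := H v (or_introl erefl); have H2 := H (- v) (or_intror erefl).
move: H1 H2; rewrite diffN// !fctE linearN opprK oppr_le0 => H1 H2.
by apply/eqP; rewrite eq_le H1 H2.
Qed.

End DifferentialRules.

Section InvertibleDifferential.
Context {R : realType}.

Lemma is_diff_mulmxr m n p (B : 'M[R]_(n, p)) (A : 'M[R]_(m, n)) :
  is_diff A (mulmxr B) (mulmxr B).
Proof.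
apply: is_diff_matrix => i j.
rewrite (_ : (fun A => _) = fun A : 'M[R]_(m, n) => \sum_l A i l * B l j);
  last by apply/funext => C; rewrite mxE.
apply: is_diff_sum => l _.
have h := is_diff_coord i l (is_diff_id A).
have := is_diff_mul h (is_diff_cst (B l j) A).
by congr is_diff_def; apply/funext => v; rewrite mulr0 add0r.
Qed.

(* A pointwise Lipschitz function is differentiable as soon as its composition
   with a map of invertible differential is. *)
Lemma is_diff_of_comp (V : normedModType R) n (u D : V -> 'rV[R]_n)
    (phi : 'rV[R]_n -> 'rV[R]_n) (A : 'M[R]_n) (x : V) (K : R) : A \in unitmx ->
  (\forall y \near x, `|u y - u x| <= K * `|y - x|) ->
  is_diff (u x) phi (mulmxr A) -> is_diff x (phi \o u) D ->
  is_diff x u (fun v => D v *m invmx A).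
Proof.
move=> uA uK [dphi phiE] [dcomp compE].
have [dB BE] := is_diff_mulmxr (invmx A) (0 : 'rV[R]_n).
have cB : continuous (mulmxr (invmx A) : 'rV[R]_n -> 'rV[R]_n).
  by move=> w; apply: differentiable_continuous;
    case: (is_diff_mulmxr (invmx A) w).
have [b b0 bP] := linear_lipschitz cB.
have K1 : 0 < `|K| + 1 by rewrite ltr_wpDl.
have uK' : \forall h \near (0 : V), `|u (h + x) - u x| <= (`|K| + 1) * `|h|.
  apply: filterS (near_shift0 uK) => h; rewrite addrK => /le_trans; apply.
  by rewrite ler_wpM2r// (le_trans (ler_norm _))// lerDl.
pose df := (mulmxr (invmx A) \o 'd (phi \o u) x) : {linear V -> 'rV[R]_n}.
have -> : (fun v => D v *m invmx A) = df.
  by apply/funext => v; rewrite /df /= compE.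
apply: is_diff_of_le.
  move=> w; apply: continuous_comp; last exact: cB.
  exact: diff_continuous.
move=> e e0.
(* [e1] controls the remainder of [phi] and [e2] that of [phi \o u]; each ends up costing
   [e / 2 * |h|]. *)
pose e1 := e / (2 * (b * (`|K| + 1))).
pose e2 := e / (2 * b).
have e1_gt0 : 0 < e1 by rewrite divr_gt0// !mulr_gt0.
have e2_gt0 : 0 < e2 by rewrite divr_gt0// mulr_gt0.
have /nbhs_ballP[r /= r0 rP] := diff_le dphi e1_gt0.
have nr : \forall h \near (0 : V), `|h| < r / (`|K| + 1).
  apply/nbhs_ballP; exists (r / (`|K| + 1)) => /=; first by rewrite divr_gt0.
  by move=> h; rewrite -ball_normE /= sub0r normrN.
apply: filterS3 uK' nr (diff_le dcomp e2_gt0) => h uh hr r2.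
set k := u (h + x) - u x in uh *.
have kr : ball (0 : 'rV[R]_n) r k.
  rewrite -ball_normE /= sub0r normrN (le_lt_trans uh)//.
  by rewrite mulrC -ltr_pdivlMr.
have := rP _ kr; rewrite /= phiE /= {1}/k subrK => r1.
(* Since [k = (k *m A) *m invmx A], the error of [u] is the difference of the two remainders
   multiplied by [invmx A]. *)
have -> : k - df h = ((phi (u (h + x)) - phi (u x) - 'd (phi \o u) x h) -
   (phi (u (h + x)) - phi (u x) - k *m A)) *m invmx A.
  rewrite opprB [X in X *m _]addrC subrKA mulmxBl mulmxK//.
rewrite (le_trans (bP _))//.
rewrite (le_trans (ler_wpM2l (ltW b0) (ler_normB _ _)))//.
have {}r1 := le_trans r1 (ler_wpM2l (ltW e1_gt0) uh).
rewrite (le_trans (ler_wpM2l (ltW b0) (lerD r2 r1)))//.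
have E1 : b * (e1 * ((`|K| + 1) * `|h|)) = e / 2 * `|h|.
  by rewrite /e1; field; rewrite !gt_eqF.
have E2 : b * (e2 * `|h|) = e / 2 * `|h|.
  by rewrite /e2; field; rewrite !gt_eqF.
by rewrite mulrDr E1 E2 -mulrDl -splitr.
Qed.
End InvertibleDifferential.

(** * Calculus of C^k maps *)

Section CkGeneral.
Context {R : realType} {d : nat} {W : normedModType R}.
Implicit Types (U : set 'rV[R]_d) (f g : 'rV[R]_d -> W).

Lemma Ck_subset k U U' f : U' `<=` U -> Ck k U f -> Ck k U' f.
Proof.
by elim: k f => [|k IH] f UU /=; [move=> H x /UU /H|
  move=> [H1 H2]; split => [x /UU /H1//|v]; exact: IH].
Qed.

(** The differentials in [Ck] are taken in the ambient space, so being C^k on a set is a condition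
    on each of its points. *)
Lemma Ck_local k U f :
  (forall x, U x -> exists2 N, N x & Ck k N f) -> Ck k U f.
Proof.
elim: k f => [|k IH] f H /=; first by move=> x /H[N Nx cf]; apply: cf.
split=> [x /H[N Nx [dfx _]]|v]; first by apply: dfx.
by apply: IH => x /H[N Nx [_ hN]]; exists N => //; exact: hN.
Qed.

Lemma CkS_is_diff k U f x : Ck k.+1 U f -> U x -> is_diff x f ('d f x).
Proof. by move=> [+ _] Ux => /(_ x Ux)/differentiableP. Qed.

(** Openness turns equality on [U] into equality near each point, so the differentials agree on [U]
    and the induction continues. *)
Lemma Ck_eq k U f g : open U -> (forall x, U x -> f x = g x) ->
  Ck k U f -> Ck k U g.
Proof.
move=> oU; have nU x : U x -> \forall y \near x, U y.
  by move=> Ux; apply: open_nbhs_nbhs.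
elim: k f g => [|k IH] f g fg /= => [cf x Ux|[df cdf]].
  have fgx : \forall y \near x, f y = g y by apply: filterS (nU x Ux).
  rewrite /prop_for /continuous_at -fg//.
  by apply: cvg_trans (cf x Ux); exact: near_eq_cvg fgx.
have D x : U x -> is_diff x g ('d f x).
  move=> Ux; apply: near_eq_is_diff (differentiableP (df x Ux)).
  by apply: filterS (nU x Ux).
split=> [x /D[]|v]; first by [].
refine (IH _ _ _ (cdf v)) => x Ux; case: (D x Ux) => _ E.
exact: esym (congr1 (fun h => h v) E).
Qed.

(** The bootstrapping step: an explicit formula [D] for the differential gains one order over the
    regularity of [D]. *)
Lemma CkS_intro k U f (D : 'rV[R]_d -> 'rV[R]_d -> W) : open U ->
  (forall x, U x -> is_diff x f (D x)) ->
  (forall v, Ck k U (fun x => D x v)) -> Ck k.+1 U f.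
Proof.
move=> oU dfD cD; split=> [x /dfD[]//|v].
by apply: Ck_eq (cD v) => // x /dfD[_ ->].
Qed.

Lemma CkS_lower k U f : Ck k.+1 U f -> Ck k U f.
Proof.
elim: k f => [|k IH] f.
  by case=> df _ x Ux; apply/differentiable_continuous/df.
by move=> [df cdf]; split=> // v; exact: IH.
Qed.

Lemma Ck_le j k U f : (j <= k)%N -> Ck k U f -> Ck j U f.
Proof.
elim: k => [|k IH]; first by rewrite leqn0 => /eqP->.
by rewrite leq_eqVlt ltnS => /predU1P[->//|/IH H /CkS_lower].
Qed.

Lemma Ck_continuous k U f x : Ck k U f -> U x -> {for x, continuous f}.
Proof. by move=> /(Ck_le (leq0n k)); exact. Qed.

Lemma Ck_cst k U (a : W) : Ck k U (fun=> a).
Proof.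
elim: k a => [|k IH] a /=; first by move=> x _; apply: cst_continuous.
split=> [x _|v]; first exact: differentiable_cst.
rewrite (_ : (fun _ => _) = fun=> 0)//.
by apply/funext => x; rewrite (_ : (fun=> a) = cst a)// diff_cst.
Qed.

Lemma Ck_sum k U (I : Type) (r : seq I) (P : pred I) (f : I -> 'rV[R]_d -> W) :
  open U -> (forall i, P i -> Ck k U (f i)) ->
  Ck k U (fun x => \sum_(i <- r | P i) f i x).
Proof.
move=> oU; elim: k f => [|k IH] f cf.
  move=> x Ux; have -> : (fun x => \sum_(i <- r | P i) f i x) =
    \sum_(i <- r | P i) f i by apply/funext => y; rewrite fct_sumE.
  elim/big_ind : _ => [||i Pi]; first exact: cst_continuous.
    by move=> g h; exact: continuousD.
  exact: cf.
apply: (@CkS_intro _ _ _ (fun x v => \sum_(i <- r | P i) 'd (f i) x v)) => //.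
  by move=> x Ux; apply: is_diff_sum => i Pi; apply: CkS_is_diff (cf i Pi) Ux.
by move=> v; apply: (IH (fun i x => 'd (f i) x v)) => i /cf[_ cdf]; apply: cdf.
Qed.

Lemma Ck_add k U f g : open U -> Ck k U f -> Ck k U g ->
  Ck k U (fun x => f x + g x).
Proof.
move=> oU cf cg.
have := @Ck_sum k U bool [:: true; false] xpredT
  (fun b => if b then f else g) oU.
have -> : (fun x : 'rV_d => \sum_(i <- [:: true; false])
    (if i then f else g) x) = fun x => f x + g x.
  by apply/funext => x; rewrite !big_cons big_nil addr0.
by apply; case.
Qed.

Lemma Ck_opp k U f : open U -> Ck k U f -> Ck k U (fun x => - f x).
Proof.
move=> oU; elim: k f => [|k IH] f cf.
  by move=> x Ux; apply: continuousN; apply: cf.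
apply: (@CkS_intro _ _ _ (fun x v => - 'd f x v)) => //.
  by move=> x Ux; apply: is_diffN (CkS_is_diff cf Ux).
by move=> v; case: cf => _ /(_ v) cdf; exact: IH.
Qed.

Lemma Ck_sub k U f g : open U -> Ck k U f -> Ck k U g ->
  Ck k U (fun x => f x - g x).
Proof. by move=> oU cf cg; apply: Ck_add => //; exact: Ck_opp. Qed.
End CkGeneral.

Section CkScalar.
Context {R : realType} {d : nat}.
Implicit Types (U : set 'rV[R]_d) (f g : 'rV[R]_d -> R).

Lemma Ck_mul k U f g : open U -> Ck k U f -> Ck k U g ->
  Ck k U (fun x => f x * g x).
Proof.
move=> oU; elim: k f g => [|k IH] f g cf cg.
  by move=> x Ux; apply: continuousM; [apply: cf|apply: cg].
apply: (@CkS_intro _ _ _ _ _ _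
  (fun x v => f x * 'd g x v + 'd f x v * g x)) => //.
  move=> x Ux; apply: is_diff_mul; first exact: CkS_is_diff cf Ux.
  exact: CkS_is_diff cg Ux.
move=> v; case: (cf) (cg) => [_ /(_ v) cdf] [_ /(_ v) cdg].
apply: Ck_add => //.
  exact: IH (CkS_lower cf) cdg.
exact: IH cdf (CkS_lower cg).
Qed.

Lemma Ck_prod k U (I : Type) (r : seq I) (P : pred I) (f : I -> 'rV[R]_d -> R) :
  open U -> (forall i, P i -> Ck k U (f i)) ->
  Ck k U (fun x => \prod_(i <- r | P i) f i x).
Proof.
move=> oU cf; have -> : (fun x => \prod_(i <- r | P i) f i x) =
    \big[(fun g h x => g x * h x)/(fun=> 1)]_(i <- r | P i) f i.
  by apply/funext => x; elim/big_rec2 : _ => // i y g Pi ->.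
elim/big_ind : _ => [||i Pi]; first exact: Ck_cst.
  by move=> g h cg ch; exact: Ck_mul.
exact: cf.
Qed.

(** The differential of [1 / f] is a polynomial in [1 / f] and ['d f], so each order of regularity
    of [1 / f] yields the next. *)
Lemma Ck_inv k U f : open U -> (forall x, U x -> f x != 0) -> Ck k U f ->
  Ck k U (fun x => (f x)^-1).
Proof.
move=> oU f0; elim: k => [|k IH] cf.
  by move=> x Ux; apply: continuousV; [apply: f0|apply: cf].
apply: (@CkS_intro _ _ _ _ _ _
  (fun x v => - ((f x)^-1 * (f x)^-1 * 'd f x v))) => //.
  by move=> x Ux; apply: is_diff_inv (CkS_is_diff cf Ux) (f0 x Ux).
move=> v; apply: Ck_opp => //; have ci := IH (CkS_lower cf).
by case: cf => _ /(_ v) cdf; apply: Ck_mul => //; exact: Ck_mul.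
Qed.

Lemma Ck_coord k U m n (f : 'rV[R]_d -> 'M[R]_(m, n)) i j : open U ->
  Ck k U f -> Ck k U (fun x => f x i j).
Proof.
move=> oU; elim: k f => [|k IH] f cf.
  move=> x Ux.
  apply: (@continuous_comp _ _ _ f (fun A : 'M[R]_(m, n) => A i j)).
    by apply: cf.
  exact: coord_continuous.
apply: (@CkS_intro _ _ _ _ _ _ (fun x v => 'd f x v i j)) => //.
  by move=> x Ux; apply: is_diff_coord (CkS_is_diff cf Ux).
by move=> v; case: cf => _ /(_ v) cdf; exact: IH.
Qed.

Lemma Ck_matrix k U m n (f : 'rV[R]_d -> 'M[R]_(m, n)) : open U ->
  (forall i j, Ck k U (fun x => f x i j)) -> Ck k U f.
Proof.
move=> oU; elim: k f => [|k IH] f cf.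
  move=> x Ux; have -> : f = fun y => \sum_i \sum_j f y i j *: delta_mx i j.
    by apply/funext => y; rewrite -matrix_sum_delta.
  have : Ck 0 U
      (fun y => \sum_i \sum_j f y i j *: (delta_mx i j : 'M[R]_(m, n))).
    apply: Ck_sum => // i _; apply: Ck_sum => // j _ y Uy.
    by apply: continuousZr_tmp; apply: cf.
  exact.
apply: (@CkS_intro _ _ _ _ _ _
  (fun x v => \matrix_(i, j) 'd (fun x => f x i j : R) x v)) => //.
  move=> x Ux; apply: is_diff_matrix => i j.
  under [X in is_diff _ _ X]eq_fun do rewrite mxE.
  apply: CkS_is_diff (cf i j) Ux.
move=> v; apply: IH => i j; case: (cf i j) => _ /(_ v).
by congr Ck; apply/funext => x; rewrite mxE.
Qed.

End CkScalar.

Section CkComposition.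
Context {R : realType} {d : nat}.
Implicit Types (U : set 'rV[R]_d) (f g : 'rV[R]_d -> R).

Lemma Ck_comp n k U (U' : set 'rV[R]_n) (f : 'rV[R]_n -> R)
    (g : 'rV[R]_d -> 'rV[R]_n) : open U ->
  (forall x, U x -> U' (g x)) -> Ck k U' f -> Ck k U g ->
  Ck k U (fun x => f (g x)).
Proof.
move=> oU UU; elim: k f => [|k IH] f cf cg.
  move=> x Ux; apply: (@continuous_comp _ _ _ g f); first by apply: cg.
  exact: cf (g x) (UU x Ux).
apply: (@CkS_intro _ _ _ _ _ _ (fun x v => 'd f (g x) ('d g x v))) => //.
  move=> x Ux; have dg := CkS_is_diff cg Ux.
  exact: (is_diff_comp dg (CkS_is_diff cf (UU _ Ux))).
(* The direction ['d g x v] moves with [x], whereas [Ck] controls ['d f] in fixed directions only;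
   expanding in the standard basis separates the two. *)
move=> v; have -> : (fun x => 'd f (g x) ('d g x v)) =
    fun x => \sum_(j < n) 'd g x v 0 j * 'd f (g x) (delta_mx 0 j).
  apply/funext => x; rewrite {1}[ 'd g x v]row_sum_delta linear_sum.
  by apply: eq_bigr => j _; rewrite linearZ.
case: (cf) (cg) => _ cdf [_ cdg].
apply: Ck_sum => // j _; apply: Ck_mul => //; last first.
  apply: (IH (fun y => 'd f y (delta_mx 0 j))); first exact: cdf.
  exact: CkS_lower.
exact: (@Ck_coord R d k U 1 n (fun x => 'd g x v) 0 j oU (cdg v)).
Qed.

Lemma Ck_comp_mx n p q k U (U' : set 'rV[R]_n) (f : 'rV[R]_n -> 'M[R]_(p, q))
    (g : 'rV[R]_d -> 'rV[R]_n) : open U -> open U' ->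
  (forall x, U x -> U' (g x)) -> Ck k U' f -> Ck k U g ->
  Ck k U (fun x => f (g x)).
Proof.
move=> oU oU' UU cf cg; apply: Ck_matrix => // i j.
by apply: (Ck_comp (f := fun y => f y i j) oU UU _ cg); exact: Ck_coord.
Qed.

Lemma Ck_id k U : open U -> Ck k U id.
Proof.
case: k => [|k] oU; first by move=> x _; exact: cvg_id.
exact: (@CkS_intro R d _ k U id (fun _ v => v) oU
  (fun x _ => is_diff_id x) (fun v => Ck_cst k U v)).
Qed.

Lemma Ck_det k U n (A : 'rV[R]_d -> 'M[R]_n) : open U ->
  (forall i j, Ck k U (fun x => A x i j)) -> Ck k U (fun x => \det (A x) : R).
Proof.
move=> oU cA; apply: Ck_sum => // s _; apply: Ck_mul => //; first exact: Ck_cst.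
by apply: Ck_prod => // i _; exact: cA.
Qed.

(** Cramer's rule: the entries of the inverse are cofactors over the determinant. *)
Lemma Ck_invmx k U n (A : 'rV[R]_d -> 'M[R]_n) i j : open U ->
  (forall x, U x -> A x \in unitmx) ->
  (forall i j, Ck k U (fun x => A x i j)) ->
  Ck k U (fun x => invmx (A x) i j : R).
Proof.
move=> oU Au cA.
apply: (@Ck_eq R d R k U (fun x => (\det (A x))^-1 * cofactor (A x) j i)) => //.
  by move=> x Ux; rewrite /invmx Au// !mxE.
apply: Ck_mul => //.
  apply: Ck_inv => //; last exact: Ck_det.
  by move=> x /Au; rewrite unitmxE unitfE.
apply: Ck_mul => //; first exact: Ck_cst.
apply: Ck_det => // i' j'.
rewrite (_ : (fun x => _) = fun x => A x (lift j i') (lift i j'))//.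
by apply/funext => x; rewrite !mxE.
Qed.

Lemma Ck_mulmx k U m n p (A : 'rV[R]_d -> 'M[R]_(m, n))
    (B : 'rV[R]_d -> 'M[R]_(n, p)) i j : open U ->
  (forall i j, Ck k U (fun x => A x i j)) ->
  (forall i j, Ck k U (fun x => B x i j)) ->
  Ck k U (fun x => (A x *m B x) i j : R).
Proof.
move=> oU cA cB.
rewrite (_ : (fun x => _) = fun x => \sum_l A x i l * B x l j).
  by apply: Ck_sum => // l _; exact: Ck_mul.
by apply/funext => x; rewrite mxE.
Qed.
End CkComposition.

(** * Nearest points *)

(** Locked, so that after expansion by bilinearity the inner products are atoms for [lra] and
    [nra]. *)
HB.lock Definition dot (R : realType) (d : nat) (x y : 'rV[R]_d) : R :=
  \sum_(i < d) x 0 i * y 0 i.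

Section DotProduct.
Context {R : realType} {d : nat}.
Implicit Types x y z : 'rV[R]_d.

Lemma dotC x y : dot x y = dot y x.
Proof. by rewrite !dot.unlock; apply: eq_bigr => i _; rewrite mulrC. Qed.

Lemma dotDl x y z : dot (x + y) z = dot x z + dot y z.
Proof.
by rewrite !dot.unlock -big_split; apply: eq_bigr => i _; rewrite mxE mulrDl.
Qed.

Lemma dotZl a x y : dot (a *: x) y = a * dot x y.
Proof.
by rewrite !dot.unlock mulr_sumr; apply: eq_bigr => i _; rewrite mxE mulrA.
Qed.

Lemma dotNl x y : dot (- x) y = - dot x y.
Proof. by rewrite -scaleN1r dotZl mulN1r. Qed.

Lemma dotDr x y z : dot z (x + y) = dot z x + dot z y.
Proof. by rewrite dotC dotDl !(dotC z). Qed.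

Lemma dotZr a x y : dot y (a *: x) = a * dot y x.
Proof. by rewrite dotC dotZl dotC. Qed.

Lemma dotNr x y : dot y (- x) = - dot y x.
Proof. by rewrite dotC dotNl dotC. Qed.

Definition dotE := (dotDl, dotDr, dotNl, dotNr, dotZl, dotZr).

Lemma dot0r x : dot x 0 = 0.
Proof. by rewrite -(scale0r x) dotZr mul0r. Qed.

Lemma dot_sumr (I : Type) (r : seq I) (P : pred I) (F : I -> 'rV[R]_d) x :
  dot x (\sum_(i <- r | P i) F i) = \sum_(i <- r | P i) dot x (F i).
Proof.
elim/big_rec2 : _ => [|i y1 y2 _ <-]; first exact: dot0r.
by rewrite dotDr.
Qed.

Lemma dotxx_ge0 x : 0 <= dot x x.
Proof.
by rewrite dot.unlock; apply: sumr_ge0 => i _; rewrite -expr2 sqr_ge0.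
Qed.

Lemma dotxx_le0 x : dot x x <= 0 -> x = 0.
Proof.
move=> x0; have /eqP : dot x x = 0 by apply/eqP; rewrite eq_le x0 dotxx_ge0.
rewrite dot.unlock psumr_eq0; last by move=> i _; rewrite -expr2 sqr_ge0.
move=> /allP H; apply/rowP => i; rewrite mxE.
have := H i (mem_index_enum i); rewrite implyTb mulf_eq0 orbb.
by move=> /eqP.
Qed.

Lemma enormE x : enorm x = Num.sqrt (dot x x).
Proof.
by congr Num.sqrt; rewrite dot.unlock; apply: eq_bigr => i _; rewrite expr2.
Qed.

Lemma norm_coord_le m n (A : 'M[R]_(m, n)) i j : `|A i j| <= `|A|.
Proof.
rewrite [leRHS]/Num.norm /= mx_normrE.
exact: (le_bigmax _ (fun ij => `|A ij.1 ij.2|) (i, j)).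
Qed.

Lemma norm_le_of_coord m n (A : 'M[R]_(m, n)) (b : R) : 0 <= b ->
  (forall i j, `|A i j| <= b) -> `|A| <= b.
Proof.
by move=> b0 H; rewrite [leLHS]/Num.norm /= mx_normrE bigmax_le.
Qed.

(** Cauchy-Schwarz for the sup norm, at the price of a factor [d]. With [norm_le_dot] it links inner
    products to the norm that measures remainders. *)
Lemma norm_dot_le x y : `|dot x y| <= d%:R * (`|x| * `|y|).
Proof.
rewrite dot.unlock (le_trans (ler_norm_sum _ _ _))//.
rewrite mulr_natl -[X in _ *+ X]card_ord -sumr_const ler_sum// => i _.
by rewrite normrM ler_pM// norm_coord_le.
Qed.

Lemma norm_le_dot x : `|x| ^+ 2 <= dot x x.
Proof.
rewrite -[leRHS]sqr_sqrtr ?dotxx_ge0// lerXn2r ?nnegrE ?sqrtr_ge0//.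
apply: norm_le_of_coord; first exact: sqrtr_ge0.
move=> i j; rewrite -sqrtr_sqr ler_wsqrtr// ord1 dot.unlock (bigD1 j)//= expr2.
by rewrite lerDl sumr_ge0// => l _; rewrite -expr2 sqr_ge0.
Qed.

Lemma continuous_dot (T : topologicalType) (f g : T -> 'rV[R]_d) (t : T) :
  {for t, continuous f} -> {for t, continuous g} ->
  {for t, continuous (fun s => dot (f s) (g s))}.
Proof.
move=> cf cg.
have c (h : T -> 'rV[R]_d) i : {for t, continuous h} ->
    {for t, continuous (fun s => h s 0 i)}.
  by move=> ch; apply: (@continuous_comp _ _ _ h (fun N : 'rV[R]_d => N 0 i));
    [exact: ch|exact: coord_continuous].
rewrite (_ : (fun s => _) = fun s => \sum_(i < d) f s 0 i * g s 0 i);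
  last by apply/funext => s; rewrite dot.unlock.
apply: (@cvg_big _ _ _ _ _ _ _ (nbhs t)) => [|i _]; first exact: add_continuous.
by apply: continuousM; exact: c.
Qed.

Lemma is_diff_dot (V : normedModType R) (f g df dg : V -> 'rV[R]_d) (x : V) :
  is_diff x f df -> is_diff x g dg ->
  is_diff x (fun y : V => dot (f y) (g y))
            (fun v => dot (f x) (dg v) + dot (df v) (g x)).
Proof.
move=> hf hg.
rewrite (_ : (fun t => _) = fun t : V => \sum_(i < d) f t 0 i * g t 0 i);
  last by apply/funext => t; rewrite dot.unlock.
have -> : (fun v => dot (f x) (dg v) + dot (df v) (g x)) =
  fun v => \sum_(i < d) (f x 0 i * dg v 0 i + df v 0 i * g x 0 i).
  by apply/funext => v; rewrite !dot.unlock big_split.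
by apply: is_diff_sum => i _; apply: is_diff_mul; exact: is_diff_coord.
Qed.

(* The second factor vanishes at x, so continuity of g is enough. *)
Lemma is_diff_dot_vanish (g : 'rV[R]_d -> 'rV[R]_d) x :
  {for x, continuous g} ->
  is_diff x (fun y => dot (g y) (y - x)) (fun v => dot (g x) v).
Proof.
move=> cg.
have [dh hE] : is_diff x (fun y => dot (g x) (y - x)) (fun v => dot (g x) v).
  have hB : is_diff x (fun y : 'rV[R]_d => y - x) (fun v => v).
    by have := is_diffB (is_diff_id x) (is_diff_cst x x); rewrite subr0.
  have := is_diff_dot (is_diff_cst (g x) x) hB.
  by congr is_diff_def; apply/funext => v; rewrite subrr dot0r addr0.
rewrite -hE; apply: is_diff_of_le; first exact: diff_continuous.
move=> e e0; rewrite hE.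
have d1 : 0 < d%:R + 1 :> R by rewrite ltr_wpDl.
pose a := e / (d%:R + 1); have a0 : 0 < a by rewrite divr_gt0.
have np : \forall h \near (0 : 'rV[R]_d), `|g x - g (h + x)| < a.
  apply: (near_shift0 (P := fun y => `|g x - g y| < a)).
  refine (@cvgr_dist_lt _ _ _ (nbhs x) _ g (g x) cg a a0).
apply: filterS np => h gh /=.
rewrite subrr dot0r subr0 addrK -dotNl -dotDl.
apply: le_trans (norm_dot_le _ _) _; rewrite mulrA ler_wpM2r//.
rewrite distrC; apply: (@le_trans _ _ (d%:R * a)).
  by rewrite ler_wpM2l// ltW.
by rewrite /a mulrCA ler_piMr ?(ltW e0)// ler_pdivrMr// mul1r lerDl.
Qed.

Lemma Ck_dot k n (U : set 'rV[R]_n) (f g : 'rV[R]_n -> 'rV[R]_d) : open U ->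
  Ck k U f -> Ck k U g -> Ck k U (fun x : 'rV[R]_n => dot (f x) (g x)).
Proof.
move=> oU cf cg.
rewrite (_ : (fun t => _) = fun t : 'rV[R]_n => \sum_(i < d) f t 0 i * g t 0 i);
  last by apply/funext => t; rewrite dot.unlock.
apply: Ck_sum => // i _.
by apply: Ck_mul => //; exact: Ck_coord.
Qed.
End DotProduct.

Section Nearest.
Context {R : realType} {d : nat} (M : set 'rV[R]_d).
Implicit Types x y q xi v : 'rV[R]_d.

(** Removes the infimum and the square root, so that nearest-point conditions become polynomial
    inequalities in inner products. *)
Lemma nearestP x xi : nearest M x xi <->
  M xi /\ forall q, M q -> dot (x - xi) (x - xi) <= dot (x - q) (x - q).
Proof.
have lb : has_lbound [set enorm (x - xi) | xi in M].
  by exists 0 => _ [q _ <-]; exact: sqrtr_ge0.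
split=> -[Mxi H]; split=> //.
  move=> q Mq; rewrite -ler_sqrt ?dotxx_ge0// -!enormE H.
  by apply: ge_inf => //; exists q.
apply/eqP; rewrite eq_le; apply/andP; split; last first.
  by apply: ge_inf => //; exists xi.
apply: lb_le_inf; first by exists (enorm (x - xi)), xi.
by move=> _ [q Mq <-]; rewrite !enormE ler_wsqrtr// H.
Qed.

Lemma proj_nearest x : unpp M x -> nearest M x (proj_to M x).
Proof. by move=> [xi [nxi _]]; exact: (getI nxi). Qed.

Lemma proj_in x : unpp M x -> M (proj_to M x).
Proof. by move=> /proj_nearest[]. Qed.

Lemma proj_le x q : unpp M x -> M q ->
  dot (x - proj_to M x) (x - proj_to M x) <= dot (x - q) (x - q).
Proof. by move=> /proj_nearest/nearestP[_]; exact. Qed.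

Lemma proj_unique x q : unpp M x -> M q ->
  (forall q', M q' -> dot (x - q) (x - q) <= dot (x - q') (x - q')) ->
  proj_to M x = q.
Proof.
move=> ux Mq H; have [xi [_ uxi]] := ux.
by rewrite -(uxi _ (proj_nearest ux)) (uxi q)//; apply/nearestP.
Qed.

Lemma dist_toE x : unpp M x ->
  dist_to M x = Num.sqrt (dot (x - proj_to M x) (x - proj_to M x)).
Proof. by move=> /proj_nearest[_ <-]; rewrite enormE. Qed.

Lemma Eset_open : open (Eset M).
Proof. exact: open_interior. Qed.

Lemma Eset_unpp x : Eset M x -> unpp M x.
Proof. exact: interior_subset. Qed.

Lemma near_Eset x : Eset M x -> \forall y \near x, Eset M y.
Proof. by move=> Ex; apply: open_nbhs_nbhs; split => //; exact: Eset_open. Qed.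

(* Otherwise q is the only possible nearest point of any point strictly
   between x and q, and such points near x lie in unpp M. *)
Lemma Eset_closure_nearest x q : Eset M x -> closure M q ->
  (forall xi, M xi -> dot (x - q) (x - q) <= dot (x - xi) (x - xi)) -> M q.
Proof.
move=> Ex Mq qmin.
have cl : (x + e *: (q - x)) @[e --> (0 : R)] --> x.
  have := cvgD (cvg_cst x) (@scalel_continuous _ _ (q - x) 0).
  by rewrite scale0r addr0; apply.
have /nbhs_ballP[r /= r0 rE] := cl _ (near_Eset Ex).
pose e := Num.min (r / 2) (1 / 2).
have e0 : 0 < e by rewrite lt_min !divr_gt0.
have e1 : e <= 1 / 2 by rewrite ge_min lexx orbT.
have er : e < r by rewrite gt_min ltr_pdivrMr// ltr_pMr// ltr1n.
pose y : 'rV[R]_d := x + e *: (q - x).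
have {rE} /Eset_unpp uy : Eset M y.
  by apply: rE; rewrite /ball /= sub0r normrN gtr0_norm.
set p := proj_to M y.
have H1 := qmin _ (proj_in uy).
(* The inequality holds at all points of [M] and is a closed condition, hence it holds at [q] in the
   closure. *)
have H2 : dot (y - p) (y - p) <= dot (y - q) (y - q).
  have : closed [set z | dot (y - p) (y - p) <= dot (y - z) (y - z)].
    have cf : continuous (fun z : 'rV[R]_d => dot (y - z) (y - z)).
      move=> z; have cz : {for z, continuous (fun t : 'rV[R]_d => y - t)}.
        by apply: continuousB; [exact: cst_continuous|exact: cvg_id].
      refine (continuous_dot cz cz).
    refine ((continuous_closedP _).1 cf _ (@closed_ge _ _)).
  by apply; apply: closure_subset Mq => z /(proj_le uy).
suff -> : q = p by exact: proj_in.
apply/eqP; rewrite -subr_eq0; apply/eqP/dotxx_le0.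
have E1 : x - p = (x - q) + (q - p) by rewrite subrKA.
have E2 : y - q = (1 - e) *: (x - q).
  by rewrite /y scalerBl scale1r -!scalerN opprB addrAC.
have E3 : y - p = (1 - e) *: (x - q) + (q - p) by rewrite -E2 subrKA.
(* With a = <x - q, q - p> and b = |q - p|^2, [H1] says 0 <= 2 a + b and [H2] says 2 (1 - e) a + b
   <= 0; together e b <= 0. *)
move: H1 H2; rewrite -/p E1 E2 E3 !dotE !(dotC p) !(dotC q x).
nra.
Qed.
End Nearest.

(* Keeps unification from unfolding the choice operator in proj_to. *)
#[local] Opaque proj_to.

(** * Continuity of the projection and the gradient of the squared distance *)

Section ProjectionContinuity.
Context {R : realType} {d : nat} (M : set 'rV[R]_d).
Implicit Types x y q xi v : 'rV[R]_d.
Local Notation p := (proj_to M).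

(** Confines [p] near [x] to a compact ball; the strict inequality at [x] makes that ball a
    neighbourhood of [p x]. For [y] near [x], [p y] is no farther from [y] than [p x], and the
    factor [d + 1] pays for the change of norms. *)
Lemma proj_bounded x : Eset M x -> exists2 B : R, `|p x| < B &
  \forall y \near x, `|p y| <= B.
Proof.
move=> Ex; have d0 : 0 <= d%:R :> R by rewrite ler0n.
pose a := `|x - p x| + 1; have a0 : 0 <= a by rewrite addr_ge0.
exists (`|x| + 1 + (d%:R + 1) * a).
  have := ler_normB x (x - p x); rewrite opprB subrKC => /le_lt_trans; apply.
  by rewrite /a; have := normr_ge0 (x - p x); nra.
have n1 : \forall y \near x, `|y - x| < 1.
  by apply/nbhs_ballP; exists 1 => //= y; rewrite -ball_normE /= distrC.
apply: filterS2 n1 (near_Eset Ex) => y yx /Eset_unpp uy.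
have H := proj_le uy (proj_in (Eset_unpp Ex)).
have ya : `|y - p x| <= a.
  rewrite -(subrKA x) (le_trans (ler_normD _ _))// addrC lerD2l.
  exact: ltW.
have yp : `|y - p y| <= (d%:R + 1) * a.
  rewrite -(@ler_pXn2r _ 2)// ?nnegrE ?mulr_ge0 ?addr_ge0//.
  apply: le_trans (norm_le_dot _) _; apply: le_trans H _.
  apply: le_trans (ler_norm _) _; apply: le_trans (norm_dot_le _ _) _.
  have : `|y - p x| * `|y - p x| <= a * a by rewrite ler_pM.
  nra.
have -> : p y = (y - x) + x - (y - p y) by rewrite subrK opprB subrKC.
rewrite (le_trans (ler_normB _ _))// lerD// (le_trans (ler_normD _ _))//.
by rewrite addrC lerD2l ltW.
Qed.

(** By compactness it suffices that [p x] is the only cluster point of [p] at [x]. A cluster point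
    lies in the closure of [M] and is at least as near to [x] as any point of [M], so
    [Eset_closure_nearest] puts it in [M]. *)
Lemma proj_continuous x : Eset M x -> {for x, continuous p}.
Proof.
move=> Ex; have [B pB nB] := proj_bounded Ex.
pose V := [set q : 'rV[R]_d | `|q| <= B].
have FV : (p @ nbhs x) V by [].
have FM : (p @ nbhs x) M.
  by apply: filterS (near_Eset Ex) => y /Eset_unpp; exact: proj_in.
have cV : compact V.
  apply: bounded_closed_compact.
    exists B; split; first exact: num_real.
    by move=> b Bb q /le_trans; apply; exact: ltW.
  refine ((continuous_closedP _).1 (@norm_continuous _ _) _ (@closed_le _ _)).
have clF q : cluster (p @ nbhs x) q -> q = p x.
  move=> clq.
  have clM : closure M q by move=> N Nq; exact: clq FM Nq.
  have qmin xi : M xi -> dot (x - q) (x - q) <= dot (x - xi) (x - xi).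
    move=> Mxi; rewrite leNgt; apply/negP => qxi.
    pose e := dot (x - q) (x - q) - dot (x - xi) (x - xi).
    have e0 : 0 < e by rewrite subr_gt0.
    (* Near [x], [G y] bounds |x - p y|^2: this exceeds |y - p y|^2 by <x - y, x + y - 2 p y>, and
       |y - p y|^2 <= |y - xi|^2. At [y = x] the error term is 0, so [p y] eventually stays away
       from [q]. *)
    pose G y := dot (y - xi) (y - xi) +
                d%:R * (`|x - y| * (`|x| + `|y| + 2 * B)).
    have cG : {for x, continuous G}.
      apply: continuousD.
        by apply: continuous_dot; apply: continuousB;
           do ?[exact: cst_continuous|exact: cvg_id].
      apply: continuousM; first exact: cst_continuous.
      apply: continuousM.
        apply: (@continuous_comp _ _ _ (fun y => x - y) Num.norm).
          by apply: continuousB; [exact: cst_continuous|exact: cvg_id].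
        exact: norm_continuous.
      apply: continuousD; last exact: cst_continuous.
      by apply: continuousD; [exact: cst_continuous|exact: norm_continuous].
    have cq : {for q, continuous (fun z : 'rV[R]_d => dot (x - z) (x - z))}.
      by apply: continuous_dot; apply: continuousB;
         do ?[exact: cst_continuous|exact: cvg_id].
    have nG : \forall y \near x, G y < dot (x - xi) (x - xi) + e / 2.
      refine (@cvgr_lt _ _ (nbhs x) _ G (G x) cG _ _).
      by rewrite /G subrr normr0 mul0r mulr0 addr0 ltrDl divr_gt0.
    have nq : \forall z \near q,
        dot (x - xi) (x - xi) + e / 2 < dot (x - z) (x - z).
      refine (@cvgr_gt _ _ (nbhs q) _ _ _ cq _ _).
      rewrite /e; lra.
    have FA : (p @ nbhs x)
        [set z | dot (x - z) (x - z) <= dot (x - xi) (x - xi) + e / 2].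
      apply: filterS3 (near_Eset Ex) nG nB => y /Eset_unpp uy Gy yB /=.
      apply: le_trans (ltW Gy).
      have H := proj_le uy Mxi.
      rewrite /G.
      apply: le_trans (lerD H (_ : dot (x - y) (x + y - 2 *: p y) <= _)).
        rewrite !dotE !(dotC (p y)) (dotC y x); lra.
      apply: le_trans (ler_norm _) _; apply: le_trans (norm_dot_le _ _) _.
      rewrite ler_wpM2l// ler_wpM2l// (le_trans (ler_normB _ _))//.
      by rewrite lerD ?ler_normD// normrZ ger0_norm// ler_wpM2l.
    have [z [/= zle zgt]] := clq _ _ FA nq.
    by have := le_lt_trans zle zgt; rewrite ltxx.
  have Mq := Eset_closure_nearest Ex clM qmin.
  by rewrite (proj_unique (Eset_unpp Ex) Mq qmin).
apply: (compact_cluster_set1 _ cV _ _ FV).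
- exact: norm_hausdorff.
- apply/nbhs_ballP; exists (B - `|p x|); first by rewrite /= subr_gt0.
  move=> q; rewrite -ball_normE /= distrC => /ltW.
  by rewrite lerBrDl; apply: le_trans; rewrite addrC -lerBlDr lerB_dist.
- apply/seteqP; split => q; first exact: clF.
  move=> ->; have [q' [_ clq']] := cV _ _ FV.
  by rewrite -(clF _ clq').
Qed.

(** A squeeze using only continuity of [p]. Testing [p x] at [x + h] bounds the remainder above by
    |h|^2; testing [p (h + x)] at [x] bounds it below by |h|^2 + 2 <h, p x - p (h + x)>. *)
Lemma is_diff_sqdist x : Eset M x ->
  is_diff x (fun y => dot (y - p y) (y - p y)) (fun v => 2 * dot (x - p x) v).
Proof.
move=> Ex; pose f y := dot (y - p y) (y - p y).
pose g y := dot (y - p x) (y - p x).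
have gD : is_diff x g (fun v => 2 * dot (x - p x) v).
  have hB : is_diff x (fun y : 'rV[R]_d => y - p x) (fun v => v).
    have := is_diffB (is_diff_id x) (is_diff_cst (p x) x).
    by rewrite subr0.
  have := is_diff_dot hB hB; congr is_diff_def.
  by apply/funext => v; rewrite (dotC v) mulr_natl mulr2n.
rewrite -(diff_val (is_diff_def := gD)).
apply: is_diff_of_le; first by apply: diff_continuous; case: gD.
move=> e e0; rewrite /= (diff_val (is_diff_def := gD)).
pose a := e / (2 * d%:R + 1).
have d0 : 0 <= d%:R :> R by rewrite ler0n.
have a0 : 0 < a by rewrite divr_gt0// ltr_wpDl// mulr_ge0.
have ae : 2 * (d%:R * a) <= e.
  by rewrite mulrA /a mulrA ler_pdivrMr ?ltr_wpDl ?mulr_ge0//; nra.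
have nh : \forall h \near (0 : 'rV[R]_d), `|h| < a.
  by apply/nbhs_ballP; exists a => //= h; rewrite -ball_normE /= sub0r normrN.
have np : \forall h \near (0 : 'rV[R]_d), `|p x - p (h + x)| < a.
  apply: (near_shift0 (P := fun y => `|p x - p y| < a)).
  refine (@cvgr_dist_lt _ _ _ (nbhs x) _ p (p x) (proj_continuous Ex) a a0).
have nE : \forall h \near (0 : 'rV[R]_d), Eset M (h + x).
  exact: near_shift0 (near_Eset Ex).
apply: filterS3 nh np nE => h ha pa /Eset_unpp uh.
have ux := Eset_unpp Ex.
have H1 := proj_le uh (proj_in ux).
have H2 := proj_le ux (proj_in uh).
have B1 : dot h h <= e * `|h|.
  apply: le_trans (ler_norm _) _; apply: le_trans (norm_dot_le _ _) _.
  rewrite mulrA ler_wpM2r// (le_trans _ ae)//.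
  by move: (ltW ha) (normr_ge0 h) d0; clear; nra.
have B2 : - (2 * dot h (p x - p (h + x))) <= e * `|h|.
  rewrite -mulrN -dotNr; apply: (@le_trans _ _ (2 * (d%:R * (`|h| * a)))).
    rewrite ler_pM2l// (le_trans (ler_norm _))// (le_trans (norm_dot_le _ _))//.
    by rewrite normrN ler_wpM2l// ler_wpM2l// ltW.
  by rewrite [`|h| * a]mulrC mulrA mulrA -(mulrA 2) ler_wpM2r.
have B3 := dotxx_ge0 h.
rewrite /f /g ler_norml; move: B1 B2 B3 H1 H2; clear.
move: (p x) (p (h + x)) (e * `|h|) => a b eh B1 B2 B3 H1 H2; apply/andP; split.
  move: B2 B3 H2; rewrite !dotE !(dotC b) !(dotC a) !(dotC x h); lra.
move: B1 H1; rewrite !dotE !(dotC b) !(dotC a) !(dotC x h); lra.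
Qed.

End ProjectionContinuity.

(** * Quadratic growth of the squared distance at the nearest point *)

Section ProjectionGrowth.
Context {R : realType} {d : nat} (M : set 'rV[R]_d).
Implicit Types x y q xi v : 'rV[R]_d.
Local Notation p := (proj_to M).

(* The Lagrange condition for z to maximize, over the ball |z - x|^2 <= tau,
   a function whose gradient at z is n, with w = z - x. *)
Lemma lagrange_ball (n w : 'rV[R]_d) (tau : R) : 0 < tau ->
  dot w w <= tau ->
  (forall v, (exists2 e0 : R, 0 < e0 & forall e : R, 0 < e -> e < e0 ->
     dot (w + e *: v) (w + e *: v) <= tau) -> dot n v <= 0) ->
  exists2 l : R, 0 <= l & n = l *: w.
Proof.
move=> t0 wt H; have [w0|w0] := eqVneq w 0.
  (* At the centre every direction is admissible, in particular [n] itself. *)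
  exists 0 => //; rewrite scale0r; apply: dotxx_le0; apply: H.
  have nn := dotxx_ge0 n.
  exists (Num.min 1 (tau / (dot n n + 1))).
    by rewrite lt_min ltr01 divr_gt0// ltr_wpDl.
  move=> e e_gt0; rewrite lt_min => /andP[e1].
  rewrite ltr_pdivlMr ?ltr_wpDl// => en.
  by rewrite w0 add0r !dotE; nra.
have W0 : 0 < dot w w.
  by rewrite lt0r dotxx_ge0 andbT; apply: contra w0 => /eqP w0;
    apply/eqP/dotxx_le0; rewrite w0.
(* A direction with [dot w v < 0] points strictly into the ball, so short steps along it are
   admissible. *)
have {}H v : dot w v < 0 -> dot n v <= 0.
  move=> wv; apply: H; have vv := dotxx_ge0 v.
  exists (- dot w v / (dot v v + 1)).
    by rewrite divr_gt0 ?oppr_gt0// ltr_wpDl.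
  move=> e e_gt0; rewrite ltr_pdivlMr ?ltr_wpDl// => ev.
  by rewrite !dotE (dotC v w); nra.
have b0 : 0 <= dot n w.
  by have := H (- w); rewrite !dotE oppr_lt0 oppr_le0; exact.
pose l := dot n w / dot w w.
exists l; first by rewrite divr_ge0// ltW.
have lW : l * dot w w = dot n w by rewrite /l divfK// gt_eqF.
apply/eqP; rewrite -subr_eq0; apply/eqP/dotxx_le0.
have E : dot (n - l *: w) (n - l *: w) = dot n n - l * dot n w.
  rewrite !dotE (dotC w n); ring: lW.
rewrite E leNgt; apply/negP => pos.
(* Tilting [n - l *: w] inward by [e *: w] gives an admissible direction whose product with [n] is
   exactly [e > 0], a contradiction. *)
pose e := (dot n n - l * dot n w) / (dot n w + 1).
have e0 : 0 < e by rewrite divr_gt0// ltr_wpDl.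
have eE : e * (dot n w + 1) = dot n n - l * dot n w.
  by rewrite divfK// gt_eqF// ltr_wpDl.
have := H (n - (l + e) *: w); rewrite !dotE (dotC w n).
have eW : 0 < e * dot w w by rewrite mulr_gt0.
have : dot n w - (l + e) * dot w w < 0 by rewrite mulrDl lW; lra.
by rewrite -mulNr => -> /(_ isT); lra.
Qed.

(* If x lies strictly between its projection and a point z having the same
   projection, comparing x with z gives quadratic growth; such a z is a
   maximizer of the squared distance on a small ball around x. *)
Lemma proj_growth x : Eset M x -> exists2 c : R, 0 < c & forall q, M q ->
  dot (x - p x) (x - p x) + c * dot (q - p x) (q - p x) <= dot (x - q) (x - q).
Proof.
move=> Ex; have ux := Eset_unpp Ex.
have [px|px] := eqVneq (p x) x.
  exists 1 => // q _; rewrite px subrr dot0r add0r mul1r.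
  by rewrite -opprB dotNl dotNr opprK.
pose s := dot (x - p x) (x - p x).
have s0 : 0 < s.
  rewrite lt0r dotxx_ge0 andbT; apply: contra px => /eqP s0.
  by rewrite eq_sym -subr_eq0; apply/eqP/dotxx_le0; rewrite -/s s0.
have /nbhs_ballP[r /= r0 rE] := near_Eset Ex.
(* The first bound keeps the Euclidean ball inside [Eset M]; the second makes [tau] smaller than the
   squared distance of [x], which forces [l > 1] below. *)
pose tau := Num.min (r ^+ 2 / 4) (s / 2).
have tau0 : 0 < tau by rewrite lt_min !divr_gt0// exprn_gt0.
have taus : tau < s.
  by rewrite gt_min [X in _ || X]ltr_pdivrMr// ltr_pMr// ltr1n orbT.
have taur : tau <= r ^+ 2 / 4 by rewrite ge_min lexx.
pose K := [set y : 'rV[R]_d | dot (y - x) (y - x) <= tau].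
have Kr y : K y -> `|y - x| <= r / 2.
  move=> Ky; rewrite -(@ler_pXn2r _ 2)// ?nnegrE ?divr_ge0 ?(ltW r0)//.
  rewrite (le_trans (norm_le_dot _))// (le_trans Ky)// (le_trans taur)//.
  by rewrite exprMn; lra.
have KE y : K y -> Eset M y.
  move=> /Kr yr; apply: rE; rewrite -ball_normE /= distrC (le_lt_trans yr)//.
  by rewrite ltr_pdivrMr// ltr_pMr// ltr1n.
have Kx : K x by rewrite /K /= subrr dot0r ltW.
have cK : compact K.
  apply: bounded_closed_compact.
    exists (`|x| + r / 2); split; first exact: num_real.
    move=> b bx y Ky /=; apply: le_trans (ltW bx).
    by rewrite -(subrK x y) addrC (le_trans (ler_normD _ _))// lerD2l Kr.
  have c : continuous (fun y : 'rV[R]_d => dot (y - x) (y - x)).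
    move=> y; have cy : {for y, continuous (fun t : 'rV[R]_d => t - x)}.
      by apply: continuousB; [exact: cvg_id|exact: cst_continuous].
    refine (continuous_dot cy cy).
  refine ((continuous_closedP _).1 c _ (@closed_le _ _)).
have [z /set_mem Kz zmax] : exists2 z, z \in K & forall y, y \in K ->
    dot (y - p y) (y - p y) <= dot (z - p z) (z - p z).
  apply: (EVT_max_rV (f := fun y => dot (y - p y) (y - p y))) => //.
    by exists x.
  apply: continuous_in_subspaceT => y /set_mem /KE Ey.
  by apply: differentiable_continuous; case: (is_diff_sqdist Ey).
have Ez := KE z Kz; have uz := Eset_unpp Ez.
have {}zmax y : K y -> dot (y - p y) (y - p y) <= dot (z - p z) (z - p z).
  by move=> Ky; apply: zmax; exact/mem_set.
have [w wE] : exists w, z - x = w by exists (z - x).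
have [l l0 zl] : exists2 l : R, 0 <= l & z - p z = l *: w.
  rewrite -wE; apply: (lagrange_ball tau0 Kz) => v [e0 e0_gt0 He].
  have [dfz dfE] := is_diff_sqdist Ez.
  rewrite -(pmulr_rle0 _ (ltr0Sn R 1)) -[leLHS]/((fun v => 2 * dot _ v) v) -dfE.
  apply: (diff_ascent_le dfz); exists e0; first exact: e0_gt0.
  move=> e e1 e2; apply: (zmax (z + e *: v)).
  by rewrite /K /= addrAC; exact: He.
(* By maximality l^2 |w|^2 = |z - p z|^2 >= s > tau >= |w|^2. *)
have l1 : 1 < l.
  have := lt_le_trans taus (zmax _ Kx); rewrite zl dotZl dotZr => H.
  have := le_lt_trans Kz H; rewrite /= wE => {}H.
  rewrite ltNge; apply/negP => l1; move: H; rewrite ltNge => /negP; apply.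
  by rewrite mulrA ler_piMl ?dotxx_ge0// mulr_ile1.
(* Here x - p z = (1 - 1/l) (z - p z). Minimality of [p z] for [z], scaled by (l - 1) / l, leaves
   the surplus |q - p z|^2 / l. *)
have G q : M q -> dot (x - p z) (x - p z) + l^-1 * dot (q - p z) (q - p z) <=
    dot (x - q) (x - q).
  move=> Mq; have := proj_le uz Mq.
  have -> : z - q = l *: w + (p z - q) by rewrite -zl subrKA.
  have xp : x - p z = (l - 1) *: w.
    by rewrite scalerBl scale1r -zl -wE opprB [_ + (x - z)]addrC subrKA.
  have -> : x - q = (l - 1) *: w + (p z - q) by rewrite -xp subrKA.
  rewrite xp zl -(opprB (p z) q); move: (p z - q) => a.
  rewrite !dotE !(dotC a) => H.
  have ll : l * l^-1 = 1 by rewrite divff// gt_eqF// (lt_trans ltr01).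
  have l_gt0 : 0 < l^-1 by rewrite invr_gt0 (lt_trans ltr01).
  have {}H : 0 <= 2 * dot w a + l^-1 * dot a a.
    have : 0 <= l^-1 * (2 * (l * dot w a) + dot a a).
      by rewrite mulr_ge0 ?(ltW l_gt0)//; move: H; lra.
    rewrite mulrDr [l^-1 * _]mulrCA [l^-1 * (l * _)]mulrA (mulrC l^-1) ll.
    by rewrite mul1r.
  have : 0 <= (l - 1) * (2 * dot w a + l^-1 * dot a a).
    by rewrite mulr_ge0// subr_ge0 ltW.
  rewrite [X in _ <= X](_ : _ = 2 * ((l - 1) * dot w a) +
    (l * l^-1) * dot a a - l^-1 * dot a a); last by ring.
  rewrite ll; lra.
exists l^-1; first by rewrite invr_gt0 (lt_trans ltr01).
suff -> : p x = p z by [].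
apply: proj_unique => //; first exact: proj_in.
move=> q Mq; apply: le_trans (G q Mq); rewrite lerDl mulr_ge0 ?dotxx_ge0//.
by rewrite invr_ge0.
Qed.

(** Adding the growth inequality at [x], tested at [p y], to the minimality of [p y] for [y] gives c
    |p y - p x|^2 <= 2 <y - x, p y - p x>. The constant depends on [x]. *)
Lemma proj_lipschitz x : Eset M x ->
  exists2 K : R, 0 < K & \forall y \near x, `|p y - p x| <= K * `|y - x|.
Proof.
move=> Ex; have [c c0 gx] := proj_growth Ex.
exists ((2 * d%:R + 1) / c); first by rewrite divr_gt0// ltr_wpDl.
apply: filterS (near_Eset Ex) => y /Eset_unpp uy.
have ux := Eset_unpp Ex.
have H1 := gx _ (proj_in uy).
have H2 := proj_le uy (proj_in ux).
move: H1 H2 {gx}; move: (p x) (p y) => a b H1 H2.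
have H3 : c * `|b - a| ^+ 2 <= 2 * (d%:R * (`|y - x| * `|b - a|)).
  apply: (@le_trans _ _ (c * dot (b - a) (b - a))).
    by rewrite ler_pM2l// norm_le_dot.
  apply: (@le_trans _ _ (2 * dot (y - x) (b - a))); last first.
    by rewrite ler_pM2l// (le_trans (ler_norm _))// norm_dot_le.
  move: H1 H2; rewrite !dotE !(dotC b) !(dotC a) ?(dotC x y); lra.
rewrite mulrAC ler_pdivlMr// mulrC.
have [->|] := eqVneq (b - a) 0.
  by rewrite normr0 mulr0 mulr_ge0// addr_ge0// mulr_ge0.
rewrite -normr_gt0 => n0; rewrite -(ler_pM2r n0).
apply: le_trans (_ : 2 * (d%:R * (`|y - x| * `|b - a|)) <= _).
  by rewrite -mulrA -expr2.
have := normr_ge0 (y - x); nra.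
Qed.
End ProjectionGrowth.

(** * The projection in a chart *)

Section Chart.
Context {R : realType} {d m k : nat} (M U V : set 'rV[R]_d).
Context (Psi Phi : 'rV[R]_d -> 'rV[R]_d).
Context (oU : open U) (oV : open V).
Context (cPsi : Ck k.+2 V Psi) (cPhi : Ck k.+2 U Phi).
Context (PhiV : forall q, U q -> V (Phi q)).
Context (PhiK : forall y, V y -> Phi (Psi y) = y)
  (PsiK : forall q, U q -> Psi (Phi q) = q).
Context (chartM : forall y, V y ->
  (M (Psi y) <-> forall i : 'I_d, (m <= i)%N -> y 0 i = 0)).
Implicit Types (x y h v w : 'rV[R]_d).
Local Notation p := (proj_to M).

Let N := [set x | Eset M x /\ U (p x)].
Let u x := Phi (p x).
Let T (i : 'I_d) w : 'rV[R]_d := 'd Psi w (delta_mx 0 i).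

(* F x vanishes at u x: its first m entries are the derivatives of
   -|x - Psi w|^2 / 2 along the coordinate directions of the chart. *)
Let F x w : 'rV[R]_d :=
  \row_i (if (i < m)%N then dot (T i w) (x - Psi w) else w 0 i).
(** The differential of [F x] at [u x]. Its first [m] entries are minus half the Hessian of |x - Psi
    w|^2 applied to [h]; the others make the system square and force [h] to be flat. *)
Let L x h : 'rV[R]_d :=
  \row_i (if (i < m)%N then dot (T i (u x)) (- 'd Psi (u x) h) +
                           dot ('d (T i) (u x) h) (x - Psi (u x)) else h 0 i).

Lemma chart_nbhs_open : open N.
Proof.
rewrite openE => x [Ex Ux]; rewrite /interior.
have nU : \forall y \near x, U (p y).
  by apply: (near_continuous (proj_continuous Ex)); exact: open_nbhs_nbhs.
by apply: filterS2 (near_Eset Ex) nU => y; split.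
Qed.

Lemma chart_u_in x : N x -> V (u x).
Proof. by move=> [_ /PhiV]. Qed.

Lemma chart_u_proj x : N x -> Psi (u x) = p x.
Proof. by move=> [_ /PsiK]. Qed.

Lemma chart_u_flat x (i : 'I_d) : N x -> (m <= i)%N -> u x 0 i = 0.
Proof.
move=> Nx mi; have Vu := chart_u_in Nx; apply: (chartM Vu).1 => //.
rewrite chart_u_proj//; apply: proj_in; case: Nx => Ex _.
exact: Eset_unpp.
Qed.

Lemma near_line (A : set 'rV[R]_d) w h : open A -> A w ->
  \forall t \near (0 : R), A (w + t *: h).
Proof.
move=> oA Aw.
have c : {for (0 : R), continuous (fun t : R => w + t *: h)}.
  by apply: continuousD; [exact: cst_continuous|exact: scalel_continuous].
apply: (near_continuous c).
by rewrite scale0r addr0; exact: open_nbhs_nbhs.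
Qed.

Lemma chart_line_in x h t : N x -> (forall i : 'I_d, (m <= i)%N -> h 0 i = 0) ->
  V (u x + t *: h) -> M (Psi (u x + t *: h)).
Proof.
move=> Nx hflat Vt; apply/(chartM Vt) => i mi.
by rewrite !mxE hflat// chart_u_flat// mulr0 addr0.
Qed.

Let dPsi w : V w -> is_diff w Psi ('d Psi w).
Proof. exact: CkS_is_diff cPsi. Qed.

Let cT i : Ck k.+1 V (T i).
Proof. by case: cPsi => _; exact. Qed.

Let dT i w : V w -> is_diff w (T i) ('d (T i) w).
Proof. exact: CkS_is_diff (cT i). Qed.

Let is_diff_res x w : V w ->
  is_diff w (fun w' => x - Psi w') (fun h => - 'd Psi w h).
Proof.
move=> Vw; have := is_diffB (is_diff_cst x w) (dPsi Vw).
by rewrite sub0r.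
Qed.

(** Along flat directions [Psi] stays in [M], where [p x] minimizes the distance to [x]; this is the
    first-order condition at [u x]. *)
Lemma chart_stationary x h : N x ->
  (forall i : 'I_d, (m <= i)%N -> h 0 i = 0) ->
  dot ('d Psi (u x) h) (x - Psi (u x)) = 0.
Proof.
move=> Nx hflat; have Vu := chart_u_in Nx.
have hr := is_diff_res x Vu.
have [dg gE] := is_diff_dot hr hr.
have H : 'd (fun w => dot (x - Psi w) (x - Psi w)) (u x) h = 0.
  apply: diff_argmin0 => //.
  apply: filterS (near_line h oV Vu) => t Vt.
  rewrite chart_u_proj//; apply: proj_le.
    by case: Nx => Ex _; exact: Eset_unpp.
  exact: chart_line_in.
move: H; rewrite gE (dotC (x - _)) dotNl => /eqP.
by rewrite -opprD oppr_eq0 -mulr2n mulrn_eq0 /= => /eqP.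
Qed.

Let T_stationary x (i : 'I_d) : N x -> (i < m)%N ->
  dot (T i (u x)) (x - Psi (u x)) = 0.
Proof.
move=> Nx im; apply: chart_stationary => // j mj.
rewrite mxE eqxx /=; case: eqP => // ji.
by move: mj; rewrite ji leqNgt im.
Qed.

Lemma chart_is_diff_F x : N x -> is_diff (u x) (F x) (L x).
Proof.
move=> Nx; have Vu := chart_u_in Nx; apply: is_diff_matrix => i j.
rewrite (_ : (fun w => F x w i j) = fun w =>
  if (j < m)%N then dot (T j w) (x - Psi w) else w i j); last first.
  by apply/funext => w; rewrite mxE ord1.
rewrite (_ : (fun h => L x h i j) = fun h =>
  if (j < m)%N then dot (T j (u x)) (- 'd Psi (u x) h) +
     dot ('d (T j) (u x) h) (x - Psi (u x)) else h i j); last first.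
  by apply/funext => h; rewrite mxE ord1.
case: (j < m)%N; last exact: is_diff_coord (is_diff_id _).
exact: is_diff_dot (dT j Vu) (is_diff_res x Vu).
Qed.

(** Stationarity of [u y] holds for [y]; replacing [y] by [x] in it costs the product with [y - x].
    That factor vanishes at [x], so continuity of [u] suffices to differentiate [F x \o u] there. *)
Lemma chart_F_comp x : N x -> \forall y \near x, F x (u y) =
  \row_(i < d) (if (i < m)%N then - dot (T i (u y)) (y - x) else 0).
Proof.
move=> Nx; have : \forall y \near x, N y.
  by apply: open_nbhs_nbhs; split => //; exact: chart_nbhs_open.
apply: filterS => y Ny; apply/rowP => i; rewrite !mxE.
case: ifPn => im; last by rewrite chart_u_flat// leqNgt.
have := T_stationary Ny im.
have -> : y - Psi (u y) = (y - x) + (x - Psi (u y)) by rewrite subrKA.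
by rewrite dotDr => /eqP; rewrite addrC addr_eq0 => /eqP.
Qed.

Lemma chart_u_continuous x : N x -> {for x, continuous u}.
Proof.
move=> [Ex Ux]; apply: (@continuous_comp _ _ _ p Phi).
  exact: proj_continuous.
exact: (Ck_continuous cPhi Ux).
Qed.

Lemma chart_is_diff_Fu x : N x -> is_diff x (F x \o u)
  (fun v => \row_(i < d) (if (i < m)%N then - dot (T i (u x)) v else 0)).
Proof.
move=> Nx; pose G y := \row_(i < d)
  (if (i < m)%N then - dot (T i (u y)) (y - x) else 0) : 'rV[R]_d.
apply: (@near_eq_is_diff _ _ _ G).
  by apply: filterS (chart_F_comp Nx) => y /= ->.
apply: is_diff_matrix => i j.
rewrite (_ : (fun y => G y i j) = fun y =>
  if (j < m)%N then - dot (T j (u y)) (y - x) else 0); last first.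
  by apply/funext => y; rewrite mxE.
under [X in is_diff _ _ X]eq_fun do rewrite mxE.
case: (j < m)%N; last exact: is_diff_cst.
apply: is_diffN; apply: is_diff_dot_vanish.
apply: (@continuous_comp _ _ _ u (T j)); first exact: chart_u_continuous.
exact: Ck_continuous (cT j) (chart_u_in Nx).
Qed.

Lemma chart_u_lipschitz x : N x ->
  exists2 K : R, 0 < K & \forall y \near x, `|u y - u x| <= K * `|y - x|.
Proof.
move=> [Ex Ux]; have [K1 K10 H1] := proj_lipschitz Ex.
have [dPhi _] := CkS_is_diff cPhi Ux.
have [K2 K20 H2] := diff_lipschitz dPhi.
exists (K2 * K1); first exact: mulr_gt0.
have {}H2 : \forall y \near x, `|Phi (p y) - Phi (p x)| <= K2 * `|p y - p x|.
  exact: near_continuous (proj_continuous Ex) H2.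
apply: filterS2 H1 H2 => y h1 /le_trans; apply.
by rewrite -mulrA ler_pM2l.
Qed.

Let is_derive_line x h s : V (u x + s *: h) ->
  is_derive s 1
    (fun t : R => dot (x - Psi (u x + t *: h)) (x - Psi (u x + t *: h)))
    (- 2 * dot ('d Psi (u x + s *: h) h) (x - Psi (u x + s *: h))).
Proof.
move=> Vs; have hr := is_diff_res x Vs.
have hl : is_diff s (fun t : R => u x + t *: h) (fun t : R => t *: h).
  by have := is_diffD (is_diff_cst (u x) s) (is_diff_scalel s h); rewrite add0r.
have [df fE] := is_diff_comp hl (is_diff_dot hr hr).
apply: DeriveDef; first exact: diff_derivable.
rewrite deriveE// fE /= scale1r (dotC (x - _)) dotNl.
by rewrite mulNr mulr_natl mulr2n opprD.
Qed.

(* Along t |-> u x + t h the squared distance to x grows at least like t^2 by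
   proj_growth, while by the mean value theorem it would be o(t^2) if its
   derivative vanished to second order at 0. *)
Lemma chart_second_order x h : N x ->
  (forall i : 'I_d, (m <= i)%N -> h 0 i = 0) ->
  'd (fun w => dot ('d Psi w h) (x - Psi w)) (u x) h = 0 -> h = 0.
Proof.
move=> Nx hflat; set psi := (fun w => _) => psih.
have Vu := chart_u_in Nx; case: (Nx) => Ex Ux.
have ctau : Ck k.+1 V (fun w => 'd Psi w h) by case: cPsi => _; exact.
have [dpsi _] := is_diff_dot (CkS_is_diff ctau Vu) (is_diff_res x Vu).
have psi0 : psi (u x) = 0 by exact: chart_stationary.
apply/eqP; apply/negPn/negP => h0.
have nh : 0 < `|h| by rewrite normr_gt0.
have [c c0 growth] := proj_growth Ex.
have [K K0 HK] := diff_lipschitz (ex_diff (is_diff_def := CkS_is_diff cPhi Ux)).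
(* Chosen so that the upper bound for the increase of [f] over [0, t] is half of the lower bound
   given by growth. *)
pose e := c * `|h| / (4 * K ^+ 2).
have e0 : 0 < e by rewrite divr_gt0 ?mulr_gt0 ?exprn_gt0.
have cl : {for (0 : R), continuous (fun t : R => u x + t *: h)}.
  by apply: continuousD; [exact: cst_continuous|exact: scalel_continuous].
have clh : {for (0 : R), continuous (fun t : R => t *: h)}.
  exact: scalel_continuous.
have cPl : {for (0 : R), continuous (fun t : R => Psi (u x + t *: h))}.
  apply: (@continuous_comp _ _ _ (fun t : R => u x + t *: h) Psi).
    exact: cl.
  by rewrite scale0r addr0; apply: (Ck_continuous cPsi Vu).
have n1 := near_line h oV Vu.
have n2 : \forall t \near (0 : R),
    `|Phi (Psi (u x + t *: h)) - u x| <= K * `|Psi (u x + t *: h) - p x|.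
  apply: (near_continuous (P := fun q => `|Phi q - u x| <= K * `|q - p x|) cPl).
  by rewrite scale0r addr0 chart_u_proj.
(* On the line through [u x] along [h], [psi] is o(t): both its value and its derivative along [h]
   vanish at [u x]. *)
have n3 : \forall t \near (0 : R),
    `|psi (t *: h + u x) - psi (u x) - 'd psi (u x) (t *: h)| <= e * `|t *: h|.
  apply: (near_continuous (P := fun v => `|psi (v + u x) - psi (u x) -
    'd psi (u x) v| <= e * `|v|) clh).
  by rewrite scale0r; exact: diff_le.
have /nbhs_ballP[r /= r0 rP] : \forall t \near (0 : R), [/\ V (u x + t *: h),
    `|t| * `|h| <= K * `|Psi (u x + t *: h) - p x| &
    `|psi (u x + t *: h)| <= e * (`|t| * `|h|)].
  apply: filterS3 n1 n2 n3 => t Vt H2 H3; split=> //.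
    by move: H2; rewrite PhiK// [_ - u x]addrC addKr normrZ.
  by move: H3; rewrite psi0 subr0 linearZ /= psih scaler0 subr0 addrC normrZ.
have {}rP t : `|t| < r -> [/\ V (u x + t *: h),
    `|t| * `|h| <= K * `|Psi (u x + t *: h) - p x| &
    `|psi (u x + t *: h)| <= e * (`|t| * `|h|)].
  by move=> tr; apply: rP; rewrite /ball /= sub0r normrN.
pose t := r / 2.
have t0 : 0 < t by rewrite divr_gt0.
have tr : t < r by rewrite ltr_pdivrMr// ltr_pMr// ltr1n.
pose f (s : R) := dot (x - Psi (u x + s *: h)) (x - Psi (u x + s *: h)).
have fder s : 0 <= s -> s <= t -> is_derive s 1 f (- 2 * psi (u x + s *: h)).
  move=> s0 st; apply: is_derive_line.
  by have [] := rP s; first by rewrite ger0_norm// (le_lt_trans st).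
(* The derivative of [f] is -2 psi, so the mean value theorem turns the bound on [psi] into one on
   [f t - f 0]. *)
have [s /itvP sP fs] : exists2 s, s \in `]0, t[%R &
    f t - f 0 = - 2 * psi (u x + s *: h) * (t - 0).
  apply: (MVT (df := fun s => - 2 * psi (u x + s *: h))) => //.
    by move=> s /itvP sP; apply: fder; rewrite !sP.
  apply: continuous_in_subspaceT => s /set_mem /itvP sP.
  have /@ex_derive : is_derive s 1 f (- 2 * psi (u x + s *: h)).
    by apply: fder; rewrite !sP.
  by move=> /derivable1_diffP /differentiable_continuous.
have tr' : `|t| < r by rewrite gtr0_norm.
have sr' : `|s| < r by rewrite gtr0_norm ?(lt_trans _ tr) ?sP.
have [Vt Kt _] := rP t tr'.
have [_ _ es] := rP s sr'.
have ft : c * dot (Psi (u x + t *: h) - p x) (Psi (u x + t *: h) - p x) <=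
    f t - f 0.
  rewrite lerBrDl /f scale0r addr0 chart_u_proj//.
  by apply: growth; exact: chart_line_in.
have ft2 : f t - f 0 <= 2 * (e * (t * `|h|)) * t.
  rewrite fs subr0 ler_pM2r// mulNr -mulrN ler_pM2l//.
  rewrite (le_trans (ler_norm _))// normrN (le_trans es)// ler_pM2l//.
  by rewrite ler_pM2r// ger0_norm ?sP// ltW// sP.
have ft3 : c * (t * `|h|) ^+ 2 <= K ^+ 2 * (2 * (e * (t * `|h|)) * t).
  apply: (@le_trans _ _ (K ^+ 2 * (c * `|Psi (u x + t *: h) - p x| ^+ 2))).
    rewrite [leRHS]mulrCA ler_pM2l// -exprMn.
    rewrite lerXn2r ?nnegrE ?mulr_ge0 ?(ltW K0)//.
      by rewrite ltW.
    by move: Kt; rewrite gtr0_norm.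
  rewrite ler_pM2l ?exprn_gt0// (le_trans _ ft2)// (le_trans _ ft)//.
  by rewrite ler_pM2l// norm_le_dot.
have E : K ^+ 2 * (2 * (e * (t * `|h|)) * t) = c * (t * `|h|) ^+ 2 / 2.
  by rewrite /e; field; rewrite gt_eqF.
move: ft3; rewrite E ler_pdivlMr// ger_pMr ?mulr_gt0 ?exprn_gt0 ?mulr_gt0//.
by rewrite lern1.
Qed.

(** The last entries of [L x h] make [h] flat. Weighting the first ones by the coordinates of [h]
    yields the derivative of <dPsi h, x - Psi> along [h], so [chart_second_order] applies. *)
Lemma chart_L_inj x h : N x -> L x h = 0 -> h = 0.
Proof.
move=> Nx Lh; have Vu := chart_u_in Nx.
have Lhi i : L x h 0 i = 0 by rewrite Lh mxE.
have hflat (i : 'I_d) : (m <= i)%N -> h 0 i = 0.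
  by move=> mi; have := Lhi i; rewrite mxE ltnNge mi.
apply: (chart_second_order Nx hflat).
pose tau w := \sum_i h 0 i *: T i w.
have -> : (fun w => dot ('d Psi w h) (x - Psi w)) =
    fun w => dot (tau w) (x - Psi w).
  apply/funext => w; congr dot.
  rewrite {1}[h]row_sum_delta linear_sum.
  by apply: eq_bigr => i _; rewrite linearZ.
have dtau : is_diff (u x) tau (fun v => \sum_i h 0 i *: 'd (T i) (u x) v).
  by apply: is_diff_sum => i _; apply: is_diffZ; exact: dT.
have [_ ->] := is_diff_dot dtau (is_diff_res x Vu).
rewrite dotC (dotC _ (x - _)) !dot_sumr -big_split /=; apply: big1 => i _.
rewrite !dotZr -mulrDr.
have [im|mi] := ltnP i m; last by rewrite hflat// mul0r.
have := Lhi i.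
rewrite mxE im (dotC (T i (u x))) (dotC ('d (T i) (u x) h)) => ->.
by rewrite mulr0.
Qed.

Let A x : 'M[R]_d := lin1_mx (L x).

(** [L x] is given as a plain function; its linearity is inherited from being a differential. *)
Let mulmxr_A x : N x -> mulmxr (A x) = L x :> ('rV[R]_d -> 'rV[R]_d).
Proof.
move=> Nx; have [_ E] := chart_is_diff_F Nx.
by apply/funext => h; rewrite /A -E /= mul_rV_lin1.
Qed.

Lemma chart_A_unit x : N x -> A x \in unitmx.
Proof.
move=> Nx; rewrite -row_free_unit; apply: inj_row_free => h hA.
apply: (chart_L_inj Nx); rewrite -mulmxr_A//; exact: hA.
Qed.

Let B x v : 'rV[R]_d :=
  \row_(i < d) (if (i < m)%N then - dot (T i (u x)) v else 0).

(** The implicit function formula for a solution already at hand: the derivative of [u] solves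
    [L x (du) = B x v]. *)
Lemma chart_is_diff_u x : N x -> is_diff x u (fun v => B x v *m invmx (A x)).
Proof.
move=> Nx; have [K _ uK] := chart_u_lipschitz Nx.
apply: (is_diff_of_comp (chart_A_unit Nx) uK _ (chart_is_diff_Fu Nx)).
by rewrite mulmxr_A//; exact: chart_is_diff_F.
Qed.

(** In the formula for the differential, [u] enters only through [Psi], [T] and ['d T] evaluated at
    [u]. If [u] is C^j, so is its differential, as long as j <= k, the regularity of ['d T]. *)
Lemma chart_u_Ck j : (j <= k.+1)%N -> Ck j N u.
Proof.
have oN := chart_nbhs_open.
elim: j => [_ x|j IH jk]; first exact: chart_u_continuous.
have cu := IH (ltnW jk).
have cPsiu : Ck j N (fun x => Psi (u x)).
  apply: (Ck_comp_mx oN oV chart_u_in _ cu).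
  by apply: Ck_le cPsi; rewrite ltnW// ltnW.
have cTu i : Ck j N (fun x => T i (u x)).
  exact: (Ck_comp_mx oN oV chart_u_in (Ck_le (ltnW jk) (cT i)) cu).
have cdTu i v : Ck j N (fun x => 'd (T i) (u x) v).
  apply: (Ck_comp_mx (f := fun w => 'd (T i) w v) oN oV chart_u_in _ cu).
  by case: (cT i) => _ /(_ v); exact: Ck_le.
apply: (CkS_intro oN chart_is_diff_u) => v.
apply: Ck_matrix => // i l; apply: Ck_mulmx => // [{}i {}l|{}i {}l].
  rewrite (_ : (fun x => _) =
      fun x => if (l < m)%N then - dot (T l (u x)) v else 0).
    case: (l < m)%N; last exact: Ck_cst.
    by apply: Ck_opp => //; apply: Ck_dot => //; exact: Ck_cst.
  by apply/funext => x; rewrite mxE.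
apply: Ck_invmx => // [x|{}i {}l]; first exact: chart_A_unit.
(* Row [i] of [A x] is [L x] at the [i]-th basis vector, where ['d Psi (u x)] takes the value
   [T i (u x)]. *)
rewrite (_ : (fun x => _) = fun x => if (l < m)%N then
    dot (T l (u x)) (- T i (u x)) +
    dot ('d (T l) (u x) (delta_mx 0 i)) (x - Psi (u x))
  else (delta_mx 0 i : 'rV[R]_d) 0 l).
  case: (l < m)%N; last exact: Ck_cst.
  apply: Ck_add => //; apply: Ck_dot => //; first exact: Ck_opp.
  by apply: Ck_sub => //; exact: Ck_id.
by apply/funext => x; rewrite !mxE.
Qed.

Lemma chart_proj_Ck : Ck k.+1 N p.
Proof.
apply: (@Ck_eq _ _ _ _ _ (fun x => Psi (u x))); first exact: chart_nbhs_open.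
  by move=> x; exact: chart_u_proj.
apply: (Ck_comp_mx chart_nbhs_open oV chart_u_in (CkS_lower cPsi)).
exact: chart_u_Ck.
Qed.
End Chart.

(** * Regularity of the projection and of the distance *)

Section ProjectionRegularity.
Context {R : realType} {d : nat} (M : set 'rV[R]_d).
Local Notation p := (proj_to M).

Lemma proj_Ck m k : submanifold m k M -> Ck k.-1 (Eset M) p.
Proof.
move=> [_ chart]; case: k chart => [|[|k]] chart.
(* For [k = 0] and [k = 1] alike, [k.-1] is 0 and the claim is continuity. *)
- by move=> x Ex; apply: proj_continuous.
- by move=> x Ex; apply: proj_continuous.
apply: Ck_local => x Ex.
have [U [V [Psi [oU oV Ux [[PsiU _ surj] cPsi [Phi [PhiK cPhi]]] chartM]]]] :=
  chart _ (proj_in (Eset_unpp Ex)).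
have PhiP q : U q -> V (Phi q) /\ Psi (Phi q) = q.
  by move=> /surj[y Vy <-]; rewrite PhiK.
exists [set x | Eset M x /\ U (p x)] => //.
by apply: (chart_proj_Ck oU oV cPsi cPhi _ PhiK _ chartM) => q /PhiP[].
Qed.

(** Within [Eset M], the points of [M] are the zeros of the continuous function |x - p x|^2. *)
Lemma Eset_setD_open : open (Eset M `\` M).
Proof.
rewrite openE => x [Ex Mx]; rewrite /interior.
have px : 0 < dot (x - p x) (x - p x).
  rewrite lt0r dotxx_ge0 andbT; apply/negP => /eqP px; apply: Mx.
  have /eqP : x - p x = 0 by apply: dotxx_le0; rewrite px.
  by rewrite subr_eq0 => /eqP ->; apply: proj_in; exact: Eset_unpp.
have [/differentiable_continuous cd _] := is_diff_sqdist Ex.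
have np : \forall y \near x, 0 < dot (y - p y) (y - p y).
  refine (@cvgr_gt _ _ (nbhs x) _ _ _ cd _ px).
apply: filterS2 (near_Eset Ex) np => y Ey py; split=> // My.
move: py; have -> : p y = y.
  apply: proj_unique => //; first exact: Eset_unpp.
  by move=> q _; rewrite subrr dot0r dotxx_ge0.
by rewrite subrr dot0r ltxx.
Qed.

Lemma dist_to_gt0 x : (Eset M `\` M) x -> 0 < dist_to M x.
Proof.
move=> [Ex Mx]; have ux := Eset_unpp Ex.
rewrite dist_toE// sqrtr_gt0 lt0r dotxx_ge0 andbT; apply/negP => /eqP px.
apply: Mx; have /eqP : x - p x = 0 by apply: dotxx_le0; rewrite px.
by rewrite subr_eq0 => /eqP ->; exact: proj_in.
Qed.

Lemma is_diff_sqrt (a : R) : 0 < a ->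
  is_diff a Num.sqrt (fun t => t * (2 * Num.sqrt a)^-1).
Proof.
move=> a0; have [da dE] := is_derive1_sqrt a0.
apply: DiffDef; first exact/derivable1_diffP.
by rewrite deriv1E//; apply/funext => t; rewrite derive1E dE.
Qed.

Lemma is_diff_dist x : (Eset M `\` M) x ->
  is_diff x (dist_to M) (fun v => dot (x - p x) v * (dist_to M x)^-1).
Proof.
move=> Ex; have d0 := dist_to_gt0 Ex; case: (Ex) => EMx _.
apply: (@near_eq_is_diff _ _ _ (fun y => Num.sqrt (dot (y - p y) (y - p y)))).
  by apply: filterS (near_Eset EMx) => y /Eset_unpp /dist_toE ->.
move: d0; rewrite dist_toE ?sqrtr_gt0; last exact: Eset_unpp.
move=> /is_diff_sqrt ds.
have := is_diff_comp (is_diff_sqdist EMx) ds.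
congr is_diff_def; apply/funext => v /=.
by rewrite invfM mulrACA divff ?mul1r// pnatr_eq0.
Qed.

(** The differential of the distance involves [p], of class C^(k-1), and the distance itself, known
    to be C^j by induction; hence the distance reaches one order more than [p]. *)
Lemma dist_to_Ck k : Ck k.-1 (Eset M) p -> Ck k (Eset M `\` M) (dist_to M).
Proof.
have oD := Eset_setD_open.
move=> /(Ck_subset (@subDsetl _ _ M)) cp.
suff H j : (j <= k)%N -> Ck j (Eset M `\` M) (dist_to M) by exact: H.
elim: j => [_ x /is_diff_dist[+ _]|j IH jk].
  exact: differentiable_continuous.
apply: (CkS_intro oD is_diff_dist) => v.
have jk' : (j <= k.-1)%N by case: k jk {cp IH}.
apply: Ck_mul => //.
  apply: Ck_dot => //; last exact: Ck_cst.
  by apply: Ck_sub => //; [exact: Ck_id|exact: Ck_le cp].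
apply: Ck_inv => //; last by apply: IH; exact: ltnW.
by move=> x /dist_to_gt0; rewrite lt0r => /andP[].
Qed.
End ProjectionRegularity.

Theorem theorem2 (R : realType) (d m k : nat) (M : set 'rV[R]_d)
    (hm : (m < d)%N) (hk : (1 <= k)%N) (hM : submanifold m k M) :
  Ck k.-1 (Eset M) (proj_to M) /\ Ck k (Eset M `\` M) (dist_to M).
Proof. by split; [|apply: dist_to_Ck]; exact: proj_Ck hM. Qed.
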